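(* For every integer $k\ge 1$, $a_k$ is the number whose base 5 digits are the base 3 digits of $k$; that is, if $k=\sum_{i\ge 1} d_i 3^{i-1}$ with $d_i\in\{0,1,2\}$, then $a_k=\sum_{i\ge 1} d_i 5^{i-1}$. Moreover, for every integer $n\ge 1$: $$\binom{2n}{n} \bmod 10=\begin{cases}0 & \text{if } n\notin\{a_k\},\\ 2 & \text{if } n\in\{a_k\} \text{ and } u_n \bmod 4=1,\\ 4 & \text{if } n\in\{a_k\} \text{ and } u_n \bmod 4=2,\\ 6 & \text{if } n\in\{a_k\} \text{ and } u_n \bmod 4=0,\\ 8 & \text{if } n\in\{a_k\} \text{ and } u_n \bmod 4=3.\end{cases}$$ Also, if $n\in\{a_k\}$, then $u_n$ is odd if and only if $n$ is odd (equivalently, $u_n$ is even if and only if $n$ is even).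
   Context: $\{a_k\}_{k\ge 1}$ denotes the set of all positive integers $n$, listed in increasing order $a_1<a_2<\cdots$, for which $\binom{2n}{n}$ is not divisible by 5. $u_n$ denotes the number of digits equal to 1 in the base 5 representation of $n$. $x \bmod m$ denotes the remainder in $\{0,\dots,m-1\}$ of $x$ on division by $m$. *)

(* Defs.v *)
From mathcomp Require Import all_boot.

Set Implicit Arguments.
Unset Strict Implicit.
Unset Printing Implicit Defensive.

Definition aset : pred nat := fun n => (0 < n) && ~~ (5 %| 'C(2 * n, n)).

Lemma aset_exp5 j : aset (5 ^ j).
Proof.
rewrite /aset expn_gt0 /=; set N := 5 ^ j.
have N0 : 0 < N by rewrite expn_gt0.
have leN : N <= 2 * N by rewrite leq_pmull.
have C0 : 0 < 'C(2 * N, N) by rewrite bin_gt0.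
have vfact M : M <= 2 * N ->
    logn 5 M`! = \sum_(1 <= k < (2 * N).+1) M %/ 5 ^ k.
  move=> leM; rewrite logn_fact // (big_cat_nat (n := M.+1) (p := (2 * N).+1)) //=.
  rewrite [X in _ = _ + X]big_nat_cond [X in _ = _ + X]big1 ?addn0 //.
  move=> k /andP[/andP[ltMk _] _]; apply: divn_small.
  by rewrite (ltn_trans ltMk) // ltn_expl.
have split_sum : logn 5 (2 * N)`! = logn 5 N`! + logn 5 N`!.
  rewrite !vfact // -big_split /=; apply: eq_bigr => k _.
  have [lekj | ltjk] := leqP k j.
    by rewrite mulSn mul1n divnDl // dvdn_exp2l.
  have lt5 : 5 * N <= 5 ^ k by rewrite -expnS leq_exp2l.
  by rewrite !divn_small // (leq_trans _ lt5) // ?ltn_pmul2r ?ltn_Pmull.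
have /(congr1 (logn 5)) := bin_fact leN.
rewrite [2 * N - N](_ : _ = N); last by rewrite mulSn mul1n addnK.
rewrite !lognM ?muln_gt0 ?fact_gt0 // split_sum => /eqP.
rewrite -[X in _ == X]add0n eqn_add2r => /eqP v0.
by rewrite -[5]expn1 pfactor_dvdn // v0.
Qed.

Lemma aset_unbounded m : exists n, (m < n) && aset n.
Proof. by exists (5 ^ m); rewrite aset_exp5 ltn_expl. Qed.

(* The indices of interest are k >= 1; a 0 = 0 only starts the recursion. *)
Fixpoint a (k : nat) : nat :=
  if k is k'.+1 then ex_minn (aset_unbounded (a k')) else 0.

Lemma ltn_aS k : a k < a k.+1.
Proof. by rewrite /=; case: ex_minnP => n /andP[]. Qed.

Lemma aset_range n : reflect (exists2 k, 0 < k & a k = n) (aset n).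
Proof.
apply: (iffP idP) => [An | [[//|k] _ <-]]; last first.
  by rewrite /=; case: ex_minnP => m /andP[].
have H j : (exists2 k, 0 < k & a k = n) \/ a j < n.
  elim: j => [|j [ex | ltjn]]; [by right; case/andP: An | by left | ].
  have: a j.+1 <= n by rewrite /=; case: ex_minnP => m _; apply; rewrite ltjn.
  by rewrite leq_eqVlt => /orP[/eqP eqn | ]; [left; exists j.+1 | right].
case: (H n) => // lt_an; suff : n <= a n by rewrite leqNgt lt_an.
by elim: (n) => // m IH; exact: leq_ltn_trans IH (ltn_aS m).
Qed.

Definition digit (b n i : nat) : nat := (n %/ b ^ i) %% b.

(* Since n < 5 ^ n, every nonzero base 5 digit of n has position i < n. *)
Definition u (n : nat) : nat := #|[set i : 'I_n | digit 5 n i == 1]|.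

(* Main.v *)
Require Import Defs.
From mathcomp Require Import all_boot.

(** Everything happens one digit at a time.

    Lucas's theorem says that modulo a prime [p] a binomial coefficient is
    the product of the binomial coefficients of its base [p] digits.  For the
    central coefficient this becomes [central_bin_lucas]:
    [C(2n, n) = C(2q, q) * C(2r, r)] modulo [p], where [n = q p + r]; when
    doubling [r] produces a carry, both sides vanish.  For [p = 5] the last
    factor is [1, 2, 6, 20, 70] for [r = 0, 1, 2, 3, 4].  Hence [C(2n, n)] is
    prime to 5 exactly when all base 5 digits of [n] are at most 2
    ([coprime5_central_step]), and then each digit 1 contributes a factor 2
    and each other digit a factor congruent to 1, so that [C(2n, n)] is
    congruent to [2 ^ u n] modulo 5 ([central_bin_mod5]).  As 2 has order 4
    modulo 5 and [C(2n, n)] is even for positive [n], the remainder modulo 10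
    is determined by [u n] modulo 4.  Since powers of 5 are odd, [n] has the
    parity of the sum of its digits, and among the digits 0, 1, 2 only 1 is
    odd: this is the claim on parities.

    Reading the base 3 digits of [k] in base 5 ([reread]) is a strictly
    increasing map, whose values are precisely the numbers with all base 5
    digits at most 2.  An infinite set of natural numbers has only one
    increasing enumeration, and both [a] and [reread] send 0 to 0, hence
    [reread] is [a] ([aE]). *)

(** * Digits *)

Lemma digit0 b n : digit b n 0 = n %% b.
Proof. by rewrite /digit expn0 divn1. Qed.

Lemma digitS b n i : digit b n i.+1 = digit b (n %/ b) i.
Proof. by rewrite /digit expnS divnMA. Qed.

Lemma digit_oversize b n i : 1 < b -> n <= i -> digit b n i = 0.
Proof.
move=> b1 le_ni; rewrite /digit divn_small ?mod0n //.
exact: leq_ltn_trans le_ni (ltn_expl i b1).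
Qed.

(** Summing over the positions below [n] amounts to summing over all of them,
    so such a sum splits off its unit digit although the bound [n %/ b] on
    the positions of the quotient is much smaller than [n.-1]. *)
Lemma sum_digits_step (F : nat -> nat -> nat) b n :
    1 < b -> (forall i, F i 0 = 0) ->
  \sum_(i < n) F i (digit b n i) =
    F 0 (n %% b) + \sum_(i < n %/ b) F i.+1 (digit b (n %/ b) i).
Proof.
move=> b1 F0.
have widen (G : nat -> nat -> nat) m N : (forall i, G i 0 = 0) -> m <= N ->
    \sum_(i < m) G i (digit b m i) = \sum_(i < N) G i (digit b m i).
  move=> G0 leN; rewrite -(subnKC leN) big_split_ord /= [X in _ = _ + X]big1.
    by rewrite addn0.
  by move=> i _; rewrite digit_oversize ?leq_addr.
rewrite (widen F n n.+1) // big_ord_recl /= digit0; congr (_ + _).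
rewrite (widen (fun i => F i.+1) _ n) ?leq_div //.
by apply: eq_bigr => i _; rewrite digitS.
Qed.

Lemma u_step n : u n = (n %% 5 == 1) + u (n %/ 5).
Proof.
have uE m : u m = \sum_(i < m) (digit 5 m i == 1).
  by rewrite /u -sum1dep_card big_mkcond /=; apply: eq_bigr => i _; case: eqP.
by rewrite !uE (sum_digits_step (fun _ d => d == 1)).
Qed.

(** * Lucas's theorem *)

(** Compare coefficients in [(1 + X) ^ (p + n) = (1 + X ^ p) (1 + X) ^ n],
    which holds modulo [p]: in Vandermonde's sum only the extreme binomial
    coefficients of [p] survive. *)
Lemma bin_add_prime p n i : prime p ->
  'C(p + n, i) = 'C(n, i) + (p <= i) * 'C(n, i - p) %[mod p].
Proof.
move=> p_pr; rewrite -(Vandermonde p n i) big_ord_recl /= bin0 mul1n subn0.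
apply/eqP; rewrite eqn_modDl; apply/eqP.
have small (j : nat) : j.+1 != p -> 'C(p, j.+1) = 0 %[mod p].
  move=> nej; have [ltj | lej] := ltnP j.+1 p.
    by apply/eqP; rewrite mod0n; apply: prime_dvd_bin; rewrite // ltj.
  by rewrite bin_small // ltn_neqAle eq_sym nej.
have p_gt0 := prime_gt0 p_pr.
have [le_pi | lt_ip] := leqP p i; last first.
  rewrite mul0n -modn_summ big1 ?mod0n // => j _; apply/eqP.
  rewrite /= /bump leq0n add1n -modnMml small ?mod0n //.
  by rewrite neq_ltn (leq_ltn_trans (ltn_ord j)).
have ltp1 : p.-1 < i by rewrite prednK.
rewrite mul1n (bigD1 (Ordinal ltp1)) //= /bump leq0n add1n prednK // binn mul1n.
rewrite -modnDmr -modn_summ big1 ?mod0n ?addn0 // => j nej.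
rewrite /= add1n -modnMml small ?mod0n //.
by apply: contraNneq nej => ejp; apply/eqP/val_inj; rewrite /= -ejp.
Qed.

(** Lucas's theorem for a unit digit.  The induction on [m] removes [p] from
    the upper index; the two terms that appear recombine by Pascal's rule for
    the quotients [m] and [k]. *)
Lemma bin_lucas p m k s r : prime p -> s < p -> r < p ->
  'C(m * p + s, k * p + r) = 'C(m, k) * 'C(s, r) %[mod p].
Proof.
move=> p_pr lt_sp lt_rp; elim: m k => [|m IHm] [|k].
- by rewrite !add0n bin0 mul1n.
- rewrite add0n bin_small // mulSn -addnA.
  exact: leq_trans lt_sp (leq_addr _ _).
- rewrite mulSn -addnA bin_add_prime // add0n leqNgt lt_rp addn0.
  by rewrite (IHm 0) !bin0.
- have ek : k.+1 * p + r = p + (k * p + r) by rewrite mulSn addnA.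
  rewrite mulSn -addnA bin_add_prime // ek leq_addr mul1n addKn -ek.
  by rewrite -modnDm !IHm modnDm -mulnDl -binS.
Qed.

(** If [p <= 2 r], doubling produces a carry and a unit digit [2 r - p < r],
    so both sides vanish modulo [p]. *)
Lemma central_bin_lucas p n : prime p ->
  'C(2 * n, n) = 'C(2 * (n %/ p), n %/ p) * 'C(2 * (n %% p), n %% p) %[mod p].
Proof.
move=> p_pr; have lt_rp := ltn_pmod n (prime_gt0 p_pr).
rewrite {1 2}(divn_eq n p) mulnDr mulnA; move: lt_rp.
move: (n %/ p) (n %% p) => q r lt_rp.
have [lt_2r_p | le_p_2r] := ltnP (2 * r) p; first exact: bin_lucas.
have lt_carry : 2 * r - p < r by rewrite ltn_subLR // mul2n -addnn ltn_add2r.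
have e2r : 2 * r = 1 * p + (2 * r - p) by rewrite mul1n subnKC.
have vanish m k : 'C(m * p + (2 * r - p), k * p + r) = 0 %[mod p].
  by rewrite bin_lucas ?(ltn_trans lt_carry) // [X in _ * X]bin_small // muln0.
rewrite e2r addnA -mulnDl vanish -modnMmr.
by have:= vanish 1 0; rewrite add0n => ->; rewrite mod0n muln0 mod0n.
Qed.

(** * Central binomial coefficients modulo 10 *)

(** By [central_bin_lucas] and Euclid's lemma, since 5 divides 20 and 70, the
    central binomial coefficients for the digits 3 and 4, but not 1, 2 and 6,
    those for the digits 0, 1 and 2. *)
Lemma coprime5_central_step n :
  ~~ (5 %| 'C(2 * n, n)) =
    ~~ (5 %| 'C(2 * (n %/ 5), n %/ 5)) && (n %% 5 < 3).
Proof.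
rewrite /dvdn central_bin_lucas // -/(dvdn _ _) Euclid_dvdM // negb_or.
congr (_ && _); have: n %% 5 < 5 by rewrite ltn_pmod.
by case: (n %% 5) => [|[|[|[|[|]]]]].
Qed.

Lemma digit5_ind (P : nat -> Prop) :
  P 0 -> (forall n, 0 < n -> P (n %/ 5) -> P n) -> forall n, P n.
Proof.
move=> P0 PS; elim/ltn_ind=> -[|n] IHn //.
by apply: PS => //; apply: IHn; rewrite ltn_Pdiv.
Qed.

Lemma central_bin_mod5 n :
  ~~ (5 %| 'C(2 * n, n)) -> 'C(2 * n, n) = 2 ^ u n %[mod 5].
Proof.
elim/digit5_ind: n => [_|n _ IHn].
  by rewrite /u -sum1dep_card big_ord0.
rewrite coprime5_central_step => /andP[/IHn {}IHn lt_r3].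
rewrite central_bin_lucas // -modnMml IHn modnMml (u_step n) addnC expnD.
rewrite -modnMmr -[in RHS]modnMmr; congr (_ * _ %% _).
by case: (n %% 5) lt_r3 => [|[|[|]]].
Qed.

Lemma odd_u n : ~~ (5 %| 'C(2 * n, n)) -> odd (u n) = odd n.
Proof.
elim/digit5_ind: n => [_|n _ IHn].
  by rewrite /u -sum1dep_card big_ord0.
rewrite coprime5_central_step => /andP[/IHn {}IHn lt_r3].
rewrite u_step [in RHS](divn_eq n 5) !oddD oddM andbT IHn addbC; congr (_ (+) _).
by case: (n %% 5) lt_r3 => [|[|[|]]].
Qed.

Lemma central_bin_even n : 0 < n -> ~~ odd 'C(2 * n, n).
Proof.
case: n => // n _; rewrite mul2n doubleS binS oddD.
have sym : n.*2.+1 - n = n.+1 by rewrite -addnn -addSn addnK.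
by rewrite -sym bin_sub ?addbb // -addnn -addSn leq_addl.
Qed.

(** The remainder modulo 10 is determined by the parity and by the remainder
    modulo 5, which is 1, 2, 4 or 3 according to the exponent of 2 modulo
    4. *)
Lemma central_bin_mod10 n : aset n ->
  'C(2 * n, n) %% 10 = nth 0 [:: 6; 2; 4; 8] (u n %% 4).
Proof.
case/andP=> n_gt0 /central_bin_mod5; move: (central_bin_even n n_gt0).
move: 'C(2 * n, n) => c evc.
have -> : 2 ^ u n = 2 ^ (u n %% 4) %[mod 5].
  rewrite [in LHS](divn_eq (u n) 4) expnD -modnMml [_ * 4]mulnC expnM.
  by rewrite -modnXm exp1n modnMml mul1n.
(* What remains is a finite check over the residues modulo 4 and 10. *)
have: u n %% 4 < 4 by rewrite ltn_pmod.
have -> : c %% 5 = (c %% 10) %% 5 by rewrite modn_dvdm.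
have {evc} : ~~ odd (c %% 10) by rewrite odd_mod.
have: c %% 10 < 10 by rewrite ltn_pmod.
case: (u n %% 4) => [|[|[|[|]]]] //;
  by case: (c %% 10) => [|[|[|[|[|[|[|[|[|[|]]]]]]]]]].
Qed.

(** * The enumeration *)

Definition reread k := \sum_(i < k) digit 3 k i * 5 ^ i.

Lemma reread_step k : reread k = reread (k %/ 3) * 5 + k %% 3.
Proof.
rewrite {1}/reread (sum_digits_step (fun i d => d * 5 ^ i)) // muln1 addnC.
congr (_ + _); rewrite big_distrl; apply: eq_bigr => i _ /=.
by rewrite expnSr mulnA.
Qed.

Lemma reread0 : reread 0 = 0.
Proof. exact: big_ord0. Qed.

Lemma rereadD q r : r < 3 -> reread (q * 3 + r) = reread q * 5 + r.
Proof.
by move=> lt_r3; rewrite reread_step divnMDl // modnMDl divn_small // modn_small // addn0.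
Qed.

Lemma ltn_mod3_5 k : k %% 3 < 5.
Proof. exact: ltn_trans (ltn_pmod k (isT : 0 < 3)) _. Qed.

Lemma reread_div k : reread k %/ 5 = reread (k %/ 3).
Proof. by rewrite reread_step divnMDl // (divn_small (ltn_mod3_5 k)) addn0. Qed.

Lemma reread_mod k : reread k %% 5 = k %% 3.
Proof. by rewrite reread_step modnMDl modn_small ?ltn_mod3_5. Qed.

Lemma digit_reread k i : digit 5 (reread k) i = digit 3 k i.
Proof.
elim: i k => [|i IHi] k; first by rewrite !digit0 reread_mod.
by rewrite !digitS reread_div.
Qed.

Lemma reread_sum m (d : nat -> nat) :
    (forall i, 1 <= i <= m -> d i \in [:: 0; 1; 2]) ->
  reread (\sum_(1 <= i < m.+1) d i * 3 ^ (i - 1)) =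
    \sum_(1 <= i < m.+1) d i * 5 ^ (i - 1).
Proof.
(* The unit digit is split off, so the induction shifts the digits [d]. *)
have split b (e : nat -> nat) j : \sum_(1 <= i < j.+2) e i * b ^ (i - 1) =
    (\sum_(1 <= i < j.+1) e i.+1 * b ^ (i - 1)) * b + e 1.
  rewrite big_nat_recl // subnn muln1 addnC; congr (_ + _).
  rewrite big_distrl /=; apply: eq_big_nat => i /andP[i_gt0 _].
  by rewrite -mulnA -expnSr subSn.
elim: m d => [|m IHm] d dP; first by rewrite !big_geq ?reread0.
rewrite !split rereadD; last by have := dP 1 isT; case: (d 1) => [|[|[|]]].
by rewrite (IHm (fun i => d i.+1)) // => i /andP[_ le_im]; exact: dP.
Qed.

Lemma reread_homo : {homo reread : j k / j < k}.
Proof.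
move=> j k; elim/ltn_ind: k j => k IHk j lt_jk.
have k_gt0 := leq_ltn_trans (leq0n j) lt_jk.
rewrite (reread_step j) (reread_step k).
have: j %/ 3 <= k %/ 3 by apply/leq_div2r/ltnW.
rewrite leq_eqVlt => /orP[/eqP eq_q | lt_q].
  rewrite eq_q ltn_add2l; move: lt_jk.
  by rewrite {1}(divn_eq j 3) {1}(divn_eq k 3) eq_q ltn_add2l.
have {IHk lt_q} lt_rr := IHk _ (ltn_Pdiv (isT : 1 < 3) k_gt0) _ lt_q.
apply: leq_trans (leq_addr _ _); apply: leq_trans (leq_mul lt_rr (leqnn 5)).
by rewrite mulSn addnC ltn_add2r ltn_mod3_5.
Qed.

(** Both inclusions compare the base 5 recursion of [coprime5_central_step]
    with the base 3 recursion of [reread]. *)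
Lemma coprime5_centralP n :
  ~~ (5 %| 'C(2 * n, n)) <-> exists k, reread k = n.
Proof.
elim/digit5_ind: n => [|n n_gt0 IHn].
  by split=> // _; exists 0; rewrite reread0.
rewrite coprime5_central_step.
split=> [/andP[/IHn[k ek] lt_r3] | [k ek]].
  by exists (k * 3 + n %% 5); rewrite rereadD // ek -divn_eq.
rewrite -[n in n %% 5]ek reread_mod ltn_pmod // andbT.
by apply/IHn; exists (k %/ 3); rewrite -ek reread_div.
Qed.

(** By induction, [a k.+1] is the least value of [reread] above [reread k],
    and this is [reread k.+1] by monotonicity. *)
Lemma aE k : a k = reread k.
Proof.
have lt_reread j i : (reread j < reread i) = (j < i).
  exact: (leqW_mono (leq_mono reread_homo)).
elim: k => [|k IHk]; first by rewrite reread0.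
rewrite /= IHk; case: ex_minnP => n /andP[lt_n /andP[_ /coprime5_centralP[j ej]]].
move=> min_n; apply/eqP; rewrite eqn_leq; apply/andP; split; last first.
  by rewrite -ej in lt_n *; rewrite leqNgt lt_reread -leqNgt -lt_reread.
apply: min_n; rewrite lt_reread ltnSn; apply/andP; split=> //.
apply/andP; split; first by have := lt_reread 0 k.+1; rewrite reread0 => ->.
by apply/coprime5_centralP; exists k.+1.
Qed.

Theorem theorem1 :
  [/\ forall k : nat, 1 <= k ->
        (forall i : nat, digit 5 (a k) i = digit 3 k i) /\
        (forall (m : nat) (d : nat -> nat),
           (forall i : nat, 1 <= i <= m -> d i \in [:: 0; 1; 2]) ->
           k = \sum_(1 <= i < m.+1) d i * 3 ^ (i - 1) ->
           a k = \sum_(1 <= i < m.+1) d i * 5 ^ (i - 1)),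
      forall n : nat, 1 <= n ->
        [/\ n \notin aset -> 'C(2 * n, n) %% 10 = 0,
            n \in aset -> u n %% 4 = 1 -> 'C(2 * n, n) %% 10 = 2,
            n \in aset -> u n %% 4 = 2 -> 'C(2 * n, n) %% 10 = 4,
            n \in aset -> u n %% 4 = 0 -> 'C(2 * n, n) %% 10 = 6 &
            n \in aset -> u n %% 4 = 3 -> 'C(2 * n, n) %% 10 = 8]
    & forall n : nat, n \in aset ->
        (odd (u n) <-> odd n) /\ (~~ odd (u n) <-> ~~ odd n)].
Proof.
split=> [k _ | n n_gt0 | n /andP[_ /odd_u ->]] //.
- split=> [i | m d dP ->]; first by rewrite aE digit_reread.
  by rewrite aE reread_sum.
- split; [rewrite unfold_in /aset n_gt0 negbK => dvd5 | move=> An eu ..];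
    try by rewrite central_bin_mod10 // eu.
  by apply/eqP; rewrite -/(dvdn 10 _) (@Gauss_dvd 2 5) // dvd5 dvdn2 central_bin_even.
Qed.
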